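(* Let $L$ be a regular language over $\{0,1\}$ and let $M=(Q,\delta,q_0,F)$ be any deterministic finite automaton recognizing $L$. For each positive integer $n$, there exists an $s$--$t$ path extended formulation of $P_n(L)$ with size at most $2|Q|n$.
   Context: Automata: a deterministic finite automaton over $\{0,1\}$ is a 4-tuple $M=(Q,\delta,q_0,F)$ with $Q$ a nonempty finite set of states, $\delta:Q\times\{0,1\}\to Q$ the transition function, $q_0\in Q$ the initial state and $F\subseteq Q$ the set of accept states. On input $x=x_1\cdots x_n\in\{0,1\}^*$ it computes $q_i=\delta(q_{i-1},x_i)$ for $i=1,\dots,n$, and accepts $x$ if $q_n\in F$. $M$ recognizes the language $L=L(M)$ of all accepted words; such languages are called regular. The polytope $P_n(L)\subseteq\mathbb{R}^n$ is the convex hull of all vectors $(x_1,\dots,x_n)^\intercal\in\{0,1\}^n$ such that the word $x_1x_2\cdots x_n$ (of length $n$) belongs to $L$. Path extensions: let $N=(V,A)$ be a finite acyclic directed graph (parallel arcs allowed) with source $s\in V$ and sink $t\in V\setminus\{s\}$. Its $s$--$t$ path polytope is $R=\operatorname{conv}\{\chi^\sigma\in\mathbb{R}^A:\sigma \text{ a directed } s\text{--}t \text{ path in } N\}$, where $\chi^\sigma$ is the characteristic vector of the arc set of $\sigma$; equivalently, $R$ is the set of $s$--$t$ flows of value $1$, i.e. $\phi\in\mathbb{R}^A$ with $\phi\geqslant0$, $\sum_{a\in\delta^+(v)}\phi_a=\sum_{a\in\delta^-(v)}\phi_a$ for all $v\in V\setminus\{s,t\}$, and $\sum_{a\in\delta^+(s)}\phi_a-\sum_{a\in\delta^-(s)}\phi_a=1$,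 where $\delta^+(v)$, $\delta^-(v)$ are the sets of arcs leaving and entering $v$. If a linear map $\pi:\mathbb{R}^A\to\mathbb{R}^d$ satisfies $\pi(R)=P$, then $R$ is an $s$--$t$ path extension of the polytope $P\subseteq\mathbb{R}^d$, and the system consisting of $x=\pi(\phi)$ together with the constraints $\phi\geqslant0$, $\sum_{a\in\delta^+(v)}\phi_a=\sum_{a\in\delta^-(v)}\phi_a$ for all $v\in V\setminus\{s,t\}$, and $\sum_{a\in\delta^+(s)}\phi_a-\sum_{a\in\delta^-(s)}\phi_a=1$ is an $s$--$t$ path extended formulation of $P$. Its size (number of inequalities) is the number of arcs $|A|$. *)

(* Defs.v *)
From HB Require Import structures.
From mathcomp Require Import all_boot all_order all_algebra.
From mathcomp Require Import all_classical all_reals convex.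

Set Implicit Arguments.
Unset Strict Implicit.
Unset Printing Implicit Defensive.

Import Order.TTheory GRing.Theory Num.Theory.

Local Open Scope classical_set_scope.
Local Open Scope ring_scope.

(** Deterministic finite automata over {0,1}, with [false] as 0 and [true]
    as 1. The state set is nonempty since it contains [initial]. *)
Record dfa := Dfa {
  state : finType;
  delta : state -> bool -> state;
  initial : state;
  accepting : {set state} }.

Definition run (M : dfa) (w : seq bool) : state M :=
  foldl (@delta M) (initial M) w.

Definition dfa_language (M : dfa) : set (seq bool) :=
  [set w | run M w \in accepting M].

Definition regular (L : set (seq bool)) : Prop :=
  exists M : dfa, dfa_language M = L.

Definition convex_hull (R : realType) (V : lmodType R) (S : set V) : set V :=
  smallest (@convex_set R V) S.

Definition language_polytope (R : realType) (n : nat) (L : set (seq bool)) :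
    set 'cV[R]_n :=
  convex_hull [set x : 'cV[R]_n |
    exists2 w : n.-tuple bool, L w & x = \col_i (tnth w i)%:R].
Arguments language_polytope R n L : clear implicits.

(** Arcs are elements of a type of their own, so that parallel arcs are
    allowed; a walk is the sequence of its arcs. *)
Fixpoint walk (V A : eqType) (tail head : A -> V) (u : V) (p : seq A) (v : V) :
    bool :=
  if p is a :: p' then (tail a == u) && walk tail head (head a) p' v
  else u == v.

Record network := Network {
  vertex : finType;
  arcs : finType;
  arc_tail : arcs -> vertex;
  arc_head : arcs -> vertex;
  source : vertex;
  sink : vertex;
  sink_neq_source : sink != source;
  acyclic : forall (v : vertex) (p : seq arcs),
    walk arc_tail arc_head v p v -> p = [::] }.

Definition st_path (N : network) (p : seq (arcs N)) : bool :=
  walk (@arc_tail N) (@arc_head N) (source N) p (sink N)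
  && uniq (source N :: map (@arc_head N) p).

(** [R^o] is [R] as a module over itself, which makes [{ffun arcs N -> R^o}]
    a module over [R]. *)
Definition path_vector (R : realType) (N : network) (p : seq (arcs N)) :
    {ffun arcs N -> R^o} :=
  [ffun a => (a \in p)%:R].

Definition path_polytope (R : realType) (N : network) :
    set {ffun arcs N -> R^o} :=
  convex_hull [set chi | exists2 p, st_path p & chi = path_vector R p].
Arguments path_polytope R N : clear implicits.

Definition outflow (R : realType) (N : network) (phi : {ffun arcs N -> R^o})
    (v : vertex N) : R := \sum_(a | arc_tail a == v) phi a.

Definition inflow (R : realType) (N : network) (phi : {ffun arcs N -> R^o})
    (v : vertex N) : R := \sum_(a | arc_head a == v) phi a.

Definition path_extension (R : realType) (N : network) (d : nat)
    (pi : {linear {ffun arcs N -> R^o} -> 'cV[R]_d}) (P : set 'cV[R]_d) : Prop :=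
  pi @` path_polytope R N = P.

Definition path_system (R : realType) (N : network) (d : nat)
    (pi : {linear {ffun arcs N -> R^o} -> 'cV[R]_d})
    (x : 'cV[R]_d) (phi : {ffun arcs N -> R^o}) : Prop :=
  [/\ x = pi phi,
      forall a, 0 <= phi a,
      forall v, v != source N -> v != sink N -> outflow phi v = inflow phi v
    & outflow phi (source N) - inflow phi (source N) = 1].

(** By flow decomposition the solutions [phi] of the flow constraints are the
    points of [path_polytope R N], so the two conjuncts are equivalent; both
    are kept, the second being what makes the system an extended formulation
    of [P]. *)
Definition path_extended_formulation (R : realType) (N : network) (d : nat)
    (pi : {linear {ffun arcs N -> R^o} -> 'cV[R]_d}) (P : set 'cV[R]_d) : Prop :=
  path_extension pi P
  /\ [set x | exists phi, path_system pi x phi] = P.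

(** The inequalities of [path_system] are [0 <= phi a], one for each arc. *)
Definition formulation_size (N : network) : nat := #|arcs N|.

(* Main.v *)
(* In a finite acyclic network every unit flow [phi] is the expected arc usage
   of a random walk that leaves a vertex through an arc with probability
   proportional to its flow; hence unit flows form the path polytope. The
   identity between [phi] and that expectation [h (source N)] is obtained by
   summing the flow-weighted differences of the potential [h] along all arcs.
   The theorem follows by unrolling the automaton into [n] layers: the arcs are
   the triples (layer, state, letter), and coordinate [i] of the projection is
   the flow through the arcs of layer [i] with letter 1. *)
Require Import Defs.
From HB Require Import structures.
From mathcomp Require Import all_boot all_order all_algebra.
From mathcomp Require Import all_classical all_reals convex.
From mathcomp Require Import interval_inference.

Set Implicit Arguments.
Unset Strict Implicit.
Unset Printing Implicit Defensive.

Import Order.TTheory GRing.Theory Num.Theory.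

Local Open Scope classical_set_scope.
Local Open Scope ring_scope.

(** * Convex hulls: affine images and finite convex combinations *)

Section ConvexHull.
Variable R : realType.

Lemma convex_setP (V : lmodType R) (A : set V) :
  @convex_set R V A <->
  forall x y (a b : R), 0 <= a -> 0 <= b -> a + b = 1 -> A x -> A y ->
    A (a *: x + b *: y).
Proof.
split=> [cA x y a b a0 b0 ab1 Ax Ay|cA x y k].
  have a1 : a <= 1 by rewrite -ab1 lerDl.
  have := cA x y (Itv01 a0 a1); rewrite !inE => /(_ Ax Ay).
  rewrite (_ : b = 1 - a) //.
  by rewrite -ab1 addrC addKr.
rewrite !inE => Ax Ay; apply: cA => //.
by rewrite subr_ge0.
by rewrite addrC subrK.
Qed.

Lemma convex_hull_convex (V : lmodType R) (S : set V) :
  @convex_set R V (convex_hull S).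
Proof.
apply/convex_setP => x y a b a0 b0 ab Sx Sy A [cA SA].
by move/convex_setP: (cA); apply=> //; [exact: Sx | exact: Sy].
Qed.

(** Affine maps pull convex sets back, and push them forward, to convex sets; minimality of the hull
    gives both inclusions. The translation [w] serves to prepend an arc to a family of walks. *)
Lemma convex_hull_image (V W : lmodType R) (f : {linear V -> W}) (w : W)
    (S : set V) :
  (fun x => w + f x) @` convex_hull S = convex_hull ((fun x => w + f x) @` S).
Proof.
have fE x y (a b : R) : a + b = 1 ->
    w + f (a *: x + b *: y) = a *: (w + f x) + b *: (w + f y).
  move=> ab1; rewrite linearD !linearZ_LR !scalerDr addrACA -scalerDl ab1.
  by rewrite scale1r.
apply/seteqP; split.
  suff H : convex_hull S `<=`
      (fun x => w + f x) @^-1` convex_hull ((fun x => w + f x) @` S).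
    by move=> _ [x Sx <-]; exact: H.
  apply: smallest_sub.
    apply/convex_setP => x y a b a0 b0 ab1 /= Sx Sy; rewrite /= fE //.
    have /convex_setP := @convex_hull_convex W ((fun x => w + f x) @` S).
    by apply.
  by move=> x Sx; apply: sub_gen_smallest; exists x.
apply: smallest_sub; last first.
  by move=> _ [x Sx <-]; exists x => //; exact: sub_gen_smallest.
apply/convex_setP => _ _ a b a0 b0 ab1 [x Sx <-] [y Sy <-].
exists (a *: x + b *: y); last exact: fE.
by move/convex_setP: (@convex_hull_convex V S); apply.
Qed.

(** Points of weight zero may lie outside [A]: they will come from arcs without flow. *)
Lemma convex_set_sum (V : lmodType R) (A : set V) (I : Type) (r : seq I)
    (P : pred I) (c : I -> R) (x : I -> V) :
  @convex_set R V A -> (forall i, P i -> 0 <= c i) ->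
  (forall i, P i -> 0 < c i -> A (x i)) ->
  \sum_(i <- r | P i) c i = 1 -> A (\sum_(i <- r | P i) c i *: x i).
Proof.
move=> /convex_setP cA c0 Ax s1.
(* Invariant for partial sums: a total weight [s] times a point of [A], or zero while no weight has
   been collected. *)
pose K (s : R) y :=
  0 <= s /\ ((s = 0 /\ y = 0) \/ exists2 z, A z & y = s *: z).
suff: K (\sum_(i <- r | P i) c i) (\sum_(i <- r | P i) c i *: x i).
  rewrite s1 => -[_ [[/eqP]|[z Az ->]]]; first by rewrite oner_eq0.
  by rewrite scale1r.
elim/big_rec2: _ => [|i y s Pi [s0 Ks]]; first by split=> //; left.
split; first by rewrite addr_ge0 ?c0.
have [ci0|ci0] := eqVneq (c i) 0.
  by rewrite ci0 scale0r !add0r.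
have ci_gt0 : 0 < c i by rewrite lt_neqAle eq_sym ci0 c0.
have t_gt0 : 0 < c i + s by rewrite ltr_wpDr.
right; case: Ks => [[-> ->]|[z Az ->]].
  by exists (x i); rewrite ?addr0 //; exact: Ax.
exists ((c i / (c i + s)) *: x i + (s / (c i + s)) *: z).
  apply: cA => //; first by rewrite divr_ge0 ?ltW.
  - by rewrite divr_ge0 // ltW.
  - by rewrite -mulrDl divff ?gt_eqF.
  - exact: Ax.
by rewrite scalerDr !scalerA !(mulrC (c i + s)) !divfK ?gt_eqF.
Qed.

End ConvexHull.

(** * Walks in acyclic networks *)

Section Network.
Variables (R : realType) (N : network).
Local Notation V := (vertex N).
Local Notation A := (arcs N).
Local Notation flow := {ffun A -> R^o}.
Local Notation nwalk := (walk (@arc_tail N) (@arc_head N)).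

Definition adjacent (u v : V) : bool :=
  [exists a : A, (arc_tail a == u) && (arc_head a == v)].

Lemma adjacent_arc (a : A) : adjacent (arc_tail a) (arc_head a).
Proof. by apply/existsP; exists a; rewrite !eqxx. Qed.

Lemma connect_walk (u v : V) : connect adjacent u v -> exists p, nwalk u p v.
Proof.
case/connectP => p; elim: p u => [|w p IHp] u /=.
  by move=> _ ->; exists [::]; rewrite /= eqxx.
case/andP => /existsP[a /andP[/eqP au /eqP aw]] wp vE.
by have [q qP] := IHp _ wp vE; exists (a :: q); rewrite /= au eqxx aw.
Qed.

Lemma arc_irrev (a : A) : ~~ connect adjacent (arc_head a) (arc_tail a).
Proof.
apply/negP => /connect_walk[p pP].
have := @acyclic N (arc_tail a) (a :: p).
by rewrite /= eqxx => /(_ pP).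
Qed.

(** The number of vertices reachable from [v], which drops along every arc and so serves as
    induction measure. *)
Definition rank (v : V) : nat := #|connect adjacent v|.

Lemma rank_arc (a : A) : (rank (arc_head a) < rank (arc_tail a))%N.
Proof.
apply/proper_card/properP; split.
  apply/fintype.subsetP => w; rewrite !inE; apply: connect_trans.
  exact/connect1/adjacent_arc.
by exists (arc_tail a); rewrite ?inE ?connect0 // arc_irrev.
Qed.

Lemma walk_rank (u v : V) (p : seq A) :
  nwalk u p v -> forall a, a \in p -> (rank (arc_head a) < rank u)%N.
Proof.
elim: p u => //= a p IHp u /andP[/eqP <- wp] b; rewrite inE.
case/predU1P => [->|bp]; first exact: rank_arc.
exact: ltn_trans (IHp _ wp _ bp) (rank_arc a).
Qed.

(** Ranks decrease strictly along a walk, so no vertex recurs; hence walks and paths coincide. *)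
Lemma walk_uniq (u v : V) (p : seq A) :
  nwalk u p v -> uniq (u :: map (@arc_head N) p).
Proof.
elim: p u => //= a p IHp u wp; rewrite IHp ?andbT; last by case/andP: wp.
apply/negP => /(@mapP _ _ (@arc_head N) (a :: p)) [b bp uE].
by have := @walk_rank u v (a :: p) wp _ bp; rewrite -uE ltnn.
Qed.

Lemma st_pathE (p : seq A) : st_path p = nwalk (source N) p (sink N).
Proof. by rewrite /st_path andb_idr //; exact: walk_uniq. Qed.

Lemma path_vector_nil : path_vector R [::] = 0 :> flow.
Proof. by apply/ffunP => a; rewrite !ffunE. Qed.

Lemma path_vector_cons (u v : V) (a : A) (p : seq A) : nwalk u (a :: p) v ->
  path_vector R (a :: p) = path_vector R [:: a] + path_vector R p :> flow.
Proof.
move=> /walk_uniq /= /andP[_ /andP[/negP ap _]]; apply/ffunP => b.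
rewrite !ffunE !inE; have [->|] := eqVneq b a; last by rewrite add0r.
rewrite (_ : a \in p = false) ?addr0 //.
by apply/negP => /(map_f (@arc_head N)).
Qed.

(** * Unit flows, potentials and flow decomposition *)

Definition unit_flow (phi : flow) : Prop :=
  [/\ forall a, 0 <= phi a,
      forall v, v != source N -> v != sink N -> outflow phi v = inflow phi v
    & outflow phi (source N) - inflow phi (source N) = 1].

Lemma outflowD (phi psi : flow) (v : V) :
  outflow (phi + psi) v = outflow phi v + outflow psi v.
Proof. by rewrite -big_split; apply: eq_bigr => a _; rewrite ffunE. Qed.

Lemma inflowD (phi psi : flow) (v : V) :
  inflow (phi + psi) v = inflow phi v + inflow psi v.
Proof. by rewrite -big_split; apply: eq_bigr => a _; rewrite ffunE. Qed.

Lemma outflowZ (c : R) (phi : flow) (v : V) :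
  outflow (c *: phi) v = c * outflow phi v.
Proof. by rewrite mulr_sumr; apply: eq_bigr => a _; rewrite ffunE. Qed.

Lemma inflowZ (c : R) (phi : flow) (v : V) :
  inflow (c *: phi) v = c * inflow phi v.
Proof. by rewrite mulr_sumr; apply: eq_bigr => a _; rewrite ffunE. Qed.

Lemma walk_netflow (u v : V) (p : seq A) : nwalk u p v -> forall x,
  outflow (path_vector R p) x - inflow (path_vector R p) x
    = (x == u)%:R - (x == v)%:R.
Proof.
have arcE (P : pred A) a : \sum_(b | P b) path_vector R [:: a] b = (P a)%:R.
  rewrite big_mkcond (bigD1 a) //= big1 ?addr0.
    by rewrite ffunE mem_head; case: (P a).
  by move=> b ba; rewrite ffunE inE (negPf ba) if_same.
elim: p u => [|a p IHp] u /=.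
  move=> /eqP -> x; rewrite path_vector_nil /outflow /inflow.
  by rewrite !big1 ?subrr // => a; rewrite ffunE.
move=> wp x; rewrite (path_vector_cons wp) outflowD inflowD opprD addrACA.
case/andP: wp => /eqP <- /IHp ->; rewrite /outflow /inflow !arcE.
by rewrite ![_ == x]eq_sym addrA subrK.
Qed.

Lemma unit_flow_convex : @convex_set R flow unit_flow.
Proof.
apply/convex_setP => x y a b a0 b0 ab [x0 xV xs] [y0 yV ys]; split.
- by move=> e; rewrite !ffunE addr_ge0 ?mulr_ge0.
- move=> v vs vt; rewrite outflowD inflowD !outflowZ !inflowZ.
  by rewrite xV // yV.
- rewrite outflowD inflowD !outflowZ !inflowZ opprD addrACA -!mulrBr xs ys.
  by rewrite !mulr1.
Qed.

Lemma st_path_unit_flow (p : seq A) : st_path p -> unit_flow (path_vector R p).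
Proof.
rewrite st_pathE => /walk_netflow pE; split.
- by move=> a; rewrite ffunE ler0n.
- move=> v vs vt; apply/eqP.
  by rewrite -subr_eq0 pE (negPf vs) (negPf vt) subrr.
- by rewrite pE eqxx eq_sym (negPf (@sink_neq_source N)) subr0.
Qed.

(** Summation by parts: grouped by vertex, the sum weights [g v] by the net outflow of [v], which is
    1 at the source, -1 at the sink and 0 elsewhere. *)
Lemma unit_flow_potential (W : lmodType R) (g : V -> W) (phi : flow) :
  unit_flow phi ->
  \sum_a (phi a : R) *: (g (arc_tail a) - g (arc_head a))
    = g (source N) - g (sink N).
Proof.
move=> [_ phiV phis].
have sumE (U : lmodType R) (f : V -> U) :
    \sum_a (phi a : R) *: (f (arc_tail a) - f (arc_head a))
    = \sum_v (outflow phi v - inflow phi v) *: f v.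
  under eq_bigr do rewrite scalerBr.
  rewrite sumrB (partition_big (@arc_tail N) predT) //=.
  rewrite [X in _ - X](partition_big (@arc_head N) predT) //= -sumrB.
  apply: eq_bigr => v _; rewrite scalerBl !scaler_suml.
  by congr (_ - _); apply: eq_bigr => a /eqP ->.
have netE (U : lmodType R) (f : V -> U) :
    \sum_v (outflow phi v - inflow phi v) *: f v
    = f (source N) + (outflow phi (sink N) - inflow phi (sink N)) *: f (sink N).
  rewrite (bigD1 (source N)) //= phis scale1r (bigD1 (sink N)) /=.
    rewrite big1 ?addr0 // => v /andP[vs vt].
    by rewrite phiV // subrr scale0r.
  exact: sink_neq_source.
(* The constraints say nothing about the sink; its net outflow follows from the constant potential
   1, for which all arc differences vanish. *)
have netT : outflow phi (sink N) - inflow phi (sink N) = -1.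
  have /eqP := netE R^o (fun=> 1); rewrite -sumE big1 => [|a _]; last first.
    by rewrite subrr scaler0.
  by rewrite eq_sym addrC addr_eq0 /GRing.scale /= mulr1 => /eqP.
by rewrite sumE netE netT scaleN1r.
Qed.

(* The potential is the indicator of the vertices strictly reachable from the
   sink: no arc decreases it, and the arcs leaving the sink increase it. *)
Lemma unit_flow_sink (phi : flow) : unit_flow phi ->
  forall a, arc_tail a = sink N -> phi a = 0.
Proof.
move=> uphi a aT; have [phi0 _ _] := uphi.
pose g v : R^o := ((v != sink N) && connect adjacent (sink N) v)%:R.
have gE b : g (arc_tail b) <= g (arc_head b).
  rewrite ler_nat; case: andP => // -[tb cb].
  rewrite (connect_trans cb (connect1 (adjacent_arc b))) andbT lt0b.
  by apply/eqP => hb; have := arc_irrev b; rewrite hb cb.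
have g_ge0 b : 0 <= (phi b : R) * (g (arc_head b) - g (arc_tail b)).
  by rewrite mulr_ge0 ?subr_ge0.
have /eqP : \sum_b (phi b : R) * (g (arc_head b) - g (arc_tail b)) = 0.
  (* All terms are nonnegative, while the potential identity makes the negated sum equal to
     [g (source N)], also nonnegative. *)
  apply/eqP; rewrite eq_le sumr_ge0 ?andbT // -oppr_ge0 -sumrN.
  have -> : \sum_b - ((phi b : R) * (g (arc_head b) - g (arc_tail b)))
      = g (source N) - g (sink N).
    rewrite -(unit_flow_potential g uphi); apply: eq_bigr => b _.
    by rewrite -mulrN opprB.
  by rewrite /g eqxx /= subr0 ler0n.
rewrite psumr_eq0 // => /allP /(_ a); rewrite mem_index_enum => /(_ isT).
rewrite /= mulf_eq0 => /orP[/eqP //|].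
have ha : arc_head a != sink N.
  by apply/eqP => hE; have := arc_irrev a; rewrite hE aT connect0.
rewrite /g aT eqxx ha /= -aT connect1 ?adjacent_arc //.
by rewrite subr0 oner_eq0.
Qed.

(* Following [phi] at random from [v]: the arc [a] leaving [v] is taken with
   probability [phi a / outflow phi v]. A solution of this recursion is the
   vector of expected arc usages. *)
Definition random_route (phi : flow) (h : V -> flow) (v : V) : flow :=
  \sum_(a | arc_tail a == v)
    (phi a / outflow phi v : R) *: (path_vector R [:: a] + h (arc_head a)).

(** After [k] iterations the values at vertices of rank at most [k] are stable, since the recursion
    only consults heads of smaller rank. *)
Lemma random_route_fixpoint (phi : flow) :
  exists h, forall v, h v = random_route phi h v.
Proof.
pose h k := iter k (random_route phi) (fun=> 0).
have hS k v : (rank v <= k)%N -> h k v = h k.+1 v.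
  elim: k v => [|k IHk] v.
    by rewrite leqn0 => /eqP/card0_eq/(_ v); rewrite inE connect0.
  move=> vk; rewrite /h [in RHS]iterS [in LHS]iterS.
  apply: eq_bigr => a /eqP av; congr (_ *: (_ + _)).
  by apply: IHk; rewrite -ltnS (leq_trans _ vk) // -av rank_arc.
by exists (h #|V|) => v; rewrite hS ?max_card.
Qed.

Lemma unit_flow_path_polytope (phi : flow) :
  unit_flow phi -> path_polytope R N phi.
Proof.
move=> uphi; have [phi0 phiV phis] := uphi.
have [h hE] := random_route_fixpoint phi.
have out_ge0 v : 0 <= outflow phi v by apply: sumr_ge0.
have in_ge v a : arc_head a = v -> phi a <= inflow phi v.
  by move=> av; rewrite /inflow (bigD1 a) ?av //= lerDl sumr_ge0.
have hsink : h (sink N) = 0.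
  rewrite hE /random_route big1 // => a /eqP aT.
  by rewrite (unit_flow_sink uphi aT) mul0r scale0r.
(* This also holds at zero outflow, where every arc leaving [v] carries no flow. *)
have outZ v : outflow phi v *: h v = \sum_(a | arc_tail a == v)
    (phi a : R) *: (path_vector R [:: a] + h (arc_head a)).
  rewrite hE scaler_sumr; apply: eq_bigr => a av; rewrite scalerA.
  have [o0|o0] := eqVneq (outflow phi v) 0; last by rewrite mulrC divfK.
  suff -> : phi a = 0 by rewrite mul0r mulr0.
  have /eqP := o0; rewrite psumr_eq0 // => /allP /(_ a).
  by rewrite mem_index_enum av => /(_ isT)/eqP.
have tailE : \sum_a (phi a : R) *: h (arc_tail a)
    = \sum_a (phi a : R) *: (path_vector R [:: a] + h (arc_head a)).
  rewrite (partition_big (@arc_tail N) predT) //=.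
  rewrite [RHS](partition_big (@arc_tail N) predT) //=.
  apply: eq_bigr => v _; rewrite -outZ scaler_suml.
  by apply: eq_bigr => a /eqP ->.
(* With [h] as potential, the recursion cancels the values at the heads and leaves the flow-weighted
   sum of single arcs, which is [phi]. *)
have phiE : phi = h (source N).
  rewrite -[RHS]subr0 -hsink -(unit_flow_potential h uphi).
  under eq_bigr do rewrite scalerBr.
  rewrite sumrB tailE -sumrB.
  under eq_bigr do rewrite scalerDr addrK.
  apply/ffunP => a; rewrite sum_ffunE (bigD1 a) //= !ffunE mem_head.
  rewrite big1 ?addr0; first by rewrite /GRing.scale /= mulr1.
  by move=> b ba; rewrite !ffunE inE eq_sym (negPf ba) scaler0.
(* Generalized from the source for induction on rank. Vertices without outflow other than the sink
   are excluded: there [h v] is zero and need not be in the hull. *)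
have hull v : v = sink N \/ 0 < outflow phi v ->
    convex_hull
      [set chi | exists2 p, nwalk v p (sink N) & chi = path_vector R p]
      (h v).
  have [k] := ubnP (rank v); elim: k v => // k IHk v vk [->|ov].
    apply: sub_gen_smallest; exists [::]; first by rewrite /= eqxx.
    by rewrite hsink path_vector_nil.
  rewrite hE; apply: convex_set_sum.
  - exact: convex_hull_convex.
  - by move=> a _; rewrite divr_ge0.
  - move=> a /eqP av; rewrite pmulr_lgt0 ?invr_gt0 // => pa.
    set S := [set _ | _].
    pose T := [set chi | exists2 p,
      nwalk (arc_head a) p (sink N) & chi = path_vector R p].
    have ha : convex_hull T (h (arc_head a)).
      apply: IHk.
        by rewrite (leq_trans _ (vk : (rank v <= k)%N)) // -av rank_arc.
      have [|/eqP hT] := eqVneq (arc_head a) (sink N); [by left | right].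
      have ia : 0 < inflow phi (arc_head a) by rewrite (lt_le_trans pa) ?in_ge.
      (* Positive inflow passes to the outflow by conservation, except at the source, where the
         outflow is the inflow plus 1. *)
      have [hs|hs] := eqVneq (arc_head a) (source N); last first.
        by rewrite phiV //; exact/eqP.
      by move/eqP: phis; rewrite -hs subr_eq => /eqP ->; rewrite addr_gt0 //.
    (* Prepending [a] to a walk translates its vector, so the hull for the head of [a] is translated
       into the hull for [v]. *)
    have TS : (fun x => path_vector R [:: a] + idfun x) @` T `<=` S.
      move=> _ [_ [p pT ->] <-]; exists (a :: p); first by rewrite /= av eqxx.
      by rewrite (@path_vector_cons v (sink N) a p) //= av eqxx.
    have := sub_smallest2r (@convex_hull_convex R _ S) TS; apply.
    by rewrite -/(convex_hull _) -convex_hull_image; exists (h (arc_head a)).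
  - by rewrite -mulr_suml divff ?gt_eqF.
rewrite phiE; apply: (@sub_smallest2r _ _ [set chi | exists2 p,
    nwalk (source N) p (sink N) & chi = path_vector R p]).
- exact: convex_hull_convex.
- by move=> _ [p pP ->]; exists p; rewrite ?st_pathE.
- apply: hull; right; move/eqP: phis; rewrite subr_eq => /eqP ->.
  by rewrite ltr_pwDl // sumr_ge0.
Qed.

Lemma unit_flow_path_polytopeE : unit_flow = path_polytope R N.
Proof.
apply/seteqP; split=> [phi|]; first exact: unit_flow_path_polytope.
apply: smallest_sub; first exact: unit_flow_convex.
by move=> _ [p pP ->]; exact: st_path_unit_flow.
Qed.

End Network.

(** * The layered network of an automaton *)

Section AutomatonNetwork.
Variables (R : realType) (M : dfa) (n : nat).
Local Notation Q := (state M).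

Definition layer_vertex : finType := ('I_n.+1 * option Q)%type.
Definition layer_arc : finType := ('I_n * Q * bool)%type.

Definition layer_tail (a : layer_arc) : layer_vertex :=
  (widen_ord (leqnSn n) a.1.1, Some a.1.2).

(* [None] merges the accept states of the last layer into the sink; the
   rejecting states of that layer stay dead ends, so that no arc needs to be
   left out. *)
Definition layer_head (a : layer_arc) : layer_vertex :=
  let q := delta a.1.2 a.2 in
  (lift ord0 a.1.1,
   if (a.1.1.+1 == n) && (q \in accepting M) then None else Some q).

Definition layer_source : layer_vertex := (ord0, Some (initial M)).
Definition layer_sink : layer_vertex := (ord_max, None).

Local Notation lwalk := (walk layer_tail layer_head).

(** Each arc advances one layer. This yields acyclicity and the length [n] of all walks from source
    to sink. *)
Lemma layer_walk_size (u v : layer_vertex) (p : seq layer_arc) :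
  lwalk u p v -> (u.1 + size p)%N = v.1.
Proof.
elim: p u => [|a p IHp] u /=; first by move=> /eqP ->; rewrite addn0.
by case/andP => /eqP <- /IHp <-; rewrite /= addnS.
Qed.

Lemma layer_acyclic (v : layer_vertex) (p : seq layer_arc) :
  lwalk v p v -> p = [::].
Proof.
move=> /layer_walk_size /eqP; rewrite -[X in _ == X]addn0 eqn_add2l.
by move=> /nilP.
Qed.

Lemma layer_sink_neq_source : layer_sink != layer_source.
Proof. by rewrite xpair_eqE andbF. Qed.

Definition automaton_network : network :=
  Network layer_sink_neq_source layer_acyclic.
Local Notation flow := {ffun arcs automaton_network -> R^o}.

Lemma card_layer_arc : #|layer_arc| = (2 * #|Q| * n)%N.
Proof. by rewrite !card_prod card_ord card_bool mulnC mulnA mulnAC. Qed.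

Definition layer_labels (phi : flow) : 'cV[R]_n :=
  \col_i \sum_q phi (i, q, true).

Lemma layer_labels_linear : linear layer_labels.
Proof.
move=> c phi psi; apply/colP => i; rewrite !mxE mulr_sumr -big_split /=.
by apply: eq_bigr => q _; rewrite !ffunE.
Qed.

HB.instance Definition _ :=
  GRing.isLinear.Build R flow 'cV[R]_n _ layer_labels layer_labels_linear.

(** * Accepted words as walks to the sink *)

Definition labels (p : seq layer_arc) : seq bool := [seq a.2 | a <- p].

Lemma walk_accepted (u : layer_vertex) (q : Q) (p : seq layer_arc) :
  u.2 = Some q -> lwalk u p layer_sink ->
  foldl (@delta M) q (labels p) \in accepting M.
Proof.
elim: p u q => [|a p IHp] u q /= uq; first by move=> /eqP uE; rewrite uE in uq.
case/andP => /eqP tE; have [_ aq] : a.1.1 = a.1.1 /\ a.1.2 = q.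
  by move: uq; rewrite -tE => -[].
case hE: (layer_head a).2 => [r|]; last first.
  (* No arc leaves a [None] vertex, so the walk ends here, and only an accepted state is merged into
     [None]. *)
  case: p {IHp} => [|b p] /=; last by case/andP => /eqP bE; rewrite -bE in hE.
  by move: hE; rewrite /= aq; case: ifP => // /andP[].
move/(IHp _ _ hE); suff -> : r = delta q a.2 by [].
by move: hE; rewrite /= aq; case: ifP => // _ [].
Qed.

(** The word must be nonempty because the sink is entered only through the arc of a last letter. *)
Lemma accepted_walk (u : layer_vertex) (q : Q) (w : seq bool) :
  u.2 = Some q -> w != [::] -> (u.1 + size w)%N = n ->
  foldl (@delta M) q w \in accepting M ->
  exists2 p, lwalk u p layer_sink & labels p = w.
Proof.
elim: w u q => //= b w IHw [k x] q /= -> _ kn acc.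
have kn' : (k < n)%N by rewrite -[X in (_ < X)%N]kn addnS ltnS leq_addr.
pose a : layer_arc := (Ordinal kn', q, b).
have tE : layer_tail a = (k, Some q) by congr pair; exact: val_inj.
have [w0|w0] := eqVneq w [::].
  exists [:: a]; last by rewrite w0.
  move: kn acc; rewrite w0 /= tE eqxx addn1 => kn acc.
  rewrite /layer_head /= kn eqxx acc /=; apply/eqP; congr pair; apply: val_inj.
  by rewrite /= /bump /= add1n kn.
have hE : (layer_head a).2 = Some (delta q b).
  rewrite /= ifF //; apply/negbTE; rewrite negb_and; apply/orP; left.
  rewrite -[X in _ == X]kn addnS eqSS -[X in X == _]addn0 eqn_add2l.
  by rewrite eq_sym size_eq0.
have [] := IHw _ _ hE w0 _ acc; first by rewrite /= /bump /= add1n addSnnS.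
by move=> p pP pw; exists (a :: p); rewrite /= ?tE ?eqxx ?pw.
Qed.

(** Stated for any starting layer to allow induction; the guard [u.1 <= i] is needed as subtraction
    is truncated, and the default [false] covers layers beyond the end of the walk. *)
Lemma layer_labels_walk (u v : layer_vertex) (p : seq layer_arc) (i : 'I_n) :
  lwalk u p v ->
  layer_labels (path_vector R (p : seq (arcs automaton_network))) i ord0
    = ((u.1 <= i)%N && nth false (labels p) (i - u.1))%:R.
Proof.
rewrite mxE; elim: p u => [|a p IHp] u wp.
  by rewrite nth_nil andbF big1 // => q _; rewrite ffunE.
rewrite (@path_vector_cons R automaton_network u v a p wp).
under eq_bigr do rewrite ffunE.
rewrite big_split /=; move: wp => /= /andP[/eqP <- /IHp ->] /=.
rewrite /bump /= add1n.
case: a => [[k r] b] /=.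
have -> : \sum_q
      path_vector R [:: (k, r, b) : arcs automaton_network] (i, q, true)
    = ((i == k) && b)%:R :> R.
  rewrite (bigD1 r) //= big1 => [|q qr].
    rewrite ffunE inE !xpair_eqE eqxx andbT addr0.
    by case: b.
  by rewrite ffunE inE !xpair_eqE (negPf qr) andbF.
have [->|ik] := eqVneq i k; first by rewrite ltnn leqnn subnn addr0.
rewrite add0r (leq_eqVlt k) eq_sym (inj_eq val_inj) (negPf ik) /=.
by case: ltnP => //= ki; rewrite -[(i - k)%N]prednK ?subn_gt0 // subnS.
Qed.

Lemma layer_labels_paths : (0 < n)%N ->
  layer_labels @` [set chi | exists2 p, st_path p & chi = path_vector R p]
  = [set x | exists2 w : n.-tuple bool,
      dfa_language M w & x = \col_i (tnth w i)%:R].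
Proof.
move=> n_gt0; have labelsE p : lwalk layer_source p layer_sink ->
    forall i : 'I_n, layer_labels
      (path_vector R (p : seq (arcs automaton_network))) i ord0
    = (nth false (labels p) i)%:R.
  by move=> pP i; rewrite (layer_labels_walk i pP) /= subn0.
apply/seteqP; split=> [_ [_ [p pP ->] <-]|_ [w Lw ->]].
  rewrite st_pathE in pP.
  have sz : size (labels p) == n.
    by rewrite size_map; apply/eqP; have := layer_walk_size pP.
  exists (Tuple sz); first exact: walk_accepted pP.
  by apply/colP => i; rewrite labelsE // mxE (tnth_nth false).
have [||p pP pw] := @accepted_walk layer_source _ w erefl _ _ Lw.
- by rewrite -size_eq0 size_tuple -lt0n.
- by rewrite size_tuple.
exists (path_vector R (p : seq (arcs automaton_network))).
  by exists p; rewrite ?st_pathE.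
by apply/colP => i; rewrite labelsE // mxE (tnth_nth false) pw.
Qed.

End AutomatonNetwork.

Theorem proposition1 (R : realType) (L : set (seq bool)) (regL : regular L)
    (M : dfa) (recM : dfa_language M = L) (n : nat) (n_gt0 : (0 < n)%N) :
  exists (N : network) (pi : {linear {ffun arcs N -> R^o} -> 'cV[R]_n}),
    path_extended_formulation pi (language_polytope R n L)
    /\ (formulation_size N <= 2 * #|state M| * n)%N.
Proof.
pose pi : {linear {ffun arcs (automaton_network M n) -> R^o} -> 'cV[R]_n} :=
  @layer_labels R M n.
have piP : path_extension pi (language_polytope R n L).
  (* The linear [pi] is treated as an affine map with translation zero. *)
  have add0 (V W : lmodType R) (f : V -> W) : (fun x => 0 + f x) = f.
    by apply/funext => x; rewrite add0r.
  rewrite /path_extension /language_polytope -recM.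
  rewrite -(layer_labels_paths _ _ n_gt0).
  by have := convex_hull_image pi 0; rewrite add0; apply.
exists (automaton_network M n), pi; split; last first.
  by rewrite /formulation_size card_layer_arc.
(* Since unit flows form the path polytope, the solutions of the system project onto the same
   image. *)
split=> //; rewrite -[RHS]piP -unit_flow_path_polytopeE.
apply/seteqP; split=> [x [phi [-> phi0 phiV phis]]|_ [phi [phi0 phiV phis] <-]].
  by exists phi.
by exists phi.
Qed.
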